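(* Let $f,h,A,\mathcal{L},\alpha,L,M$ be as in the context, assume conditions (A1)–(A4) of the context, and let $\{(x^k,y^k)\}_{k\ge 0}$ be a sequence generated by the PPDG iteration with stepsize $\alpha>0$ and $M=\alpha AA^T$, where $\alpha$ is such that, for some fixed $\delta>0$, the constants $a,b,c$ of the context are positive. Suppose that $\{(x^k,y^k)\}$ is bounded, and let $\mathcal{C}$ denote the set of its cluster points. Then: (i) $\sum_{k=1}^{\infty}\|x^{k+1}-x^k\|^2<\infty$ and $\sum_{k=1}^{\infty}\|y^{k+1}-y^k\|^2<\infty$; (ii) $\mathcal{C}$ is a nonempty compact set and $\lim_{k\to\infty}\mathrm{dist}((x^k,y^k),\mathcal{C})=0$; (iii) $\mathcal{C}\subseteq\mathrm{crit}\,\mathcal{L}$; (iv) $\mathcal{L}$ is finite and constant on $\mathcal{C}$.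
   Context: Setting. $\mathbb{X},\mathbb{Y}$ are finite-dimensional real inner product spaces with duals $\mathbb{X}^*,\mathbb{Y}^*$ (identified with $\mathbb{X},\mathbb{Y}$ via the inner products); $f:\mathbb{X}\to\mathbb{R}$ is continuously differentiable (possibly nonconvex), $A:\mathbb{X}\to\mathbb{Y}$ is linear with adjoint $A^T$, and $h:\mathbb{Y}\to(-\infty,+\infty]$ is possibly nonsmooth and nonconvex. The conjugate is $h^*(y)=\sup_{u\in\mathbb{Y}}\{\langle y,u\rangle-h(u)\}$, a convex lower semicontinuous function with convex subdifferential $\partial h^*$. Define $\mathcal{L}(x,y):=f(x)+\langle y,Ax\rangle-h^*(y)$ on $\mathbb{X}\times\mathbb{Y}^*$, $\partial\mathcal{L}(x,y):=\{\nabla f(x)+A^Ty\}\times(Ax-\partial h^*(y))$, and $\mathrm{crit}\,\mathcal{L}:=\{(x,y):0\in\partial\mathcal{L}(x,y)\}$, i.e. the set of $(x,y)$ with $\nabla f(x)+A^Ty=0$ and $Ax\in\partial h^*(y)$. Assumptions. (A1) there is $L>0$ with $\|\nabla f(x)-\nabla f(z)\|\le L\|x-z\|$ for all $x,z\in\mathbb{X}$. (A2) $\inf_{x\in\mathbb{X}}\mathcal{L}(x,y)>-\infty$ for every $y\in\mathbb{Y}^*$. (A3) $A$ is surjective. (A4) the convex hull of the function $h$ is proper. PPDG iteration. Given $(x^0,y^0)\in\mathbb{X}\times\mathbb{Y}^*$, $\alpha>0$ and $M=\alpha AA^T$ (positive definite), for $k\ge0$: $x^{k+1}=x^k-\alpha(\nabla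 f(x^k)+A^Ty^k)$, and $y^{k+1}=\mathrm{prox}^{M}_{h^*}\big(y^k+M^{-1}A(2x^{k+1}-x^k)\big)$, where $\mathrm{prox}^M_{h^*}(w)=\arg\min_{y}\{h^*(y)+\tfrac12\langle M(y-w),y-w\rangle\}$. Constants. For $\delta>0$: $a:=\frac{\delta}{\alpha}$, $b:=\frac{1}{2\alpha}-\frac{L}{4}-\frac{\delta}{\alpha}-\frac{\alpha\delta L^2}{2}-\delta L+\frac{\alpha L^2}{4\delta}$, $c:=b-\frac{\alpha L^2}{2\delta}$. (For instance $\delta=1/5$ and $\alpha\in(0,\frac{1}{3L})$ make $a,b,c$ positive.) *)

(* Defs.v *)
From HB Require Import structures.
From mathcomp Require Import all_boot all_order all_algebra.
From mathcomp Require Import all_classical all_reals all_analysis.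

Set Implicit Arguments.
Unset Strict Implicit.
Unset Printing Implicit Defensive.

Import Order.TTheory GRing.Theory Num.Theory.
Import numFieldNormedType.Exports.

Local Open Scope classical_set_scope.
Local Open Scope ring_scope.

(* Finite-dimensional real inner product spaces.  The topology and the norm are
   those of the library's normed modules; [dotvv] forces the norm to be the one
   induced by the inner product.  Duals are identified with the spaces. *)
HB.mixin Record NormedVector_isEuclidean (R : realType) V
    of NormedModule R V & Vector R V := {
  dotv : V -> V -> R ;
  dotvC : forall u v, dotv u v = dotv v u ;
  dotvDl : forall u v w, dotv (u + v) w = dotv u w + dotv v w ;
  dotvZl : forall (t : R) u v, dotv (t *: u) v = t * dotv u v ;
  dotvv : forall v, dotv v v = `|v| ^+ 2
}.

#[short(type="euclideanType")]
HB.structure Definition Euclidean (R : realType) :=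
  {V of NormedModule R V & Vector R V & NormedVector_isEuclidean R V}.

Notation "''[' u , v ]" := (dotv u v) : ring_scope.

Section Operators.
Context {R : realType} {X Y : euclideanType R}.

Definition is_adjoint (A : 'Hom(X, Y)) (At : 'Hom(Y, X)) :=
  forall x y, '[A x, y] = '[x, At y].

Definition C1_with_gradient (f : X -> R) (gradf : X -> X) :=
  [/\ forall x, differentiable f x,
      forall x v, 'd f x v = '[gradf x, v] &
      continuous gradf].

End Operators.

Section ConvexAnalysis.
Context {R : realType} {Y : euclideanType R}.
Local Open Scope ereal_scope.
Implicit Types (g : Y -> \bar R) (y v w : Y).

Definition proper_efun g := (forall u, -oo < g u) /\ (exists u, g u < +oo).

Definition epigraph g : set (Y * R^o) := [set p | g p.1 <= (p.2 : R)%:E].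

(* Greatest convex function majorized by g: the lower boundary of the convex
   hull of the epigraph of g. *)
Definition convex_hull_fun g : Y -> \bar R := fun u =>
  ereal_inf [set t%:E | t in
    [set t : R | smallest (@convex_set R (Y * R^o)%type) (epigraph g) (u, t)]].

Definition fenchel_conj g : Y -> \bar R := fun y =>
  ereal_sup (range (fun u => '[y, u]%:E - g u)).

(* Empty outside the effective domain of g. *)
Definition subdiff g y : set Y :=
  [set v | g y \is a fin_num /\ forall z, g y + '[v, (z - y)%R]%:E <= g z].

Definition argmin g : set Y := [set y | forall z, g y <= g z].

Definition prox (M : 'End(Y)) g w : set Y :=
  argmin (fun y => g y + (2^-1 * '[M (y - w)%R, (y - w)%R])%:E).

End ConvexAnalysis.

Section PPDG.
Context {R : realType} {X Y : euclideanType R}.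

Section Lagrangian.
Variables (f : X -> R) (gradf : X -> X) (A : 'Hom(X, Y)) (At : 'Hom(Y, X)).
Variable h : Y -> \bar R.

Definition lagr (x : X) (y : Y) : \bar R :=
  ((f x + '[y, A x])%:E - fenchel_conj h y)%E.

Definition subdiff_lagr (x : X) (y : Y) : set (X * Y) :=
  [set gradf x + At y] `*` [set A x - v | v in subdiff (fenchel_conj h) y].

Definition crit_lagr : set (X * Y) := [set p | subdiff_lagr p.1 p.2 (0, 0)].

Definition ppdg_metric (alpha : R) : 'End(Y) := alpha *: (A \o At)%VF.

Definition ppdg_iteration (alpha : R) (x : nat -> X) (y : nat -> Y) :=
  let M := ppdg_metric alpha in
  forall k : nat,
    x k.+1 = x k - alpha *: (gradf (x k) + At (y k)) /\
    prox M (fenchel_conj h)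
      (y k + (M^-1)%VF (A (2 *: x k.+1 - x k))) (y k.+1).

End Lagrangian.

(* Distance to a set for the norm of the product inner product; the library's
   norm on X * Y is the equivalent max norm. *)
Definition dist_to (C : set (X * Y)) (p : X * Y) : \bar R :=
  ereal_inf [set (Num.sqrt (`|p.1 - q.1| ^+ 2 + `|p.2 - q.2| ^+ 2))%:E
            | q in C].

End PPDG.

Section Constants.
Context {R : realType}.
Variables L alpha delta : R.

Definition ppdg_a : R := delta / alpha.

Definition ppdg_b : R :=
  1 / (2 * alpha) - L / 4 - delta / alpha - alpha * delta * L ^+ 2 / 2
  - delta * L + alpha * L ^+ 2 / (4 * delta).

Definition ppdg_c : R := ppdg_b - alpha * L ^+ 2 / (2 * delta).

End Constants.

(* Main.v *)
Require Import Defs.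
From HB Require Import structures.
From mathcomp Require Import all_boot all_order all_algebra.
From mathcomp Require Import all_classical all_reals all_analysis.
From mathcomp Require Import ring lra.

Set Implicit Arguments.
Unset Strict Implicit.
Unset Printing Implicit Defensive.

Import Order.TTheory GRing.Theory Num.Theory.
Import numFieldNormedType.Exports.

Local Open Scope classical_set_scope.
Local Open Scope ring_scope.

(* Write g for the conjugate of h, p_k = x^(k+1) - x^k and
   d_k = grad f(x^(k+1)) - grad f(x^k).  Since alpha A^T y^k is determined by
   the primal step, the prox step says that xi_k = A (x^(k+2) + alpha d_k) is a
   subgradient of g at y^(k+1).  The descent lemma in x and this subgradient
   inequality in y give
     L(x^(k+2), y^(k+2)) <= L(x^(k+1), y^(k+1)) - (1/alpha - L/2) |p_(k+1)|^2
                            + <p_(k+2) - p_(k+1) + alpha d_(k+1), d_k>,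
   and Young's inequality with weight delta/alpha turns L, corrected by
   multiples of |p_k|^2 and |p_(k+1)|^2, into a function decreasing by
   2c |p_(k+1)|^2.  It is bounded below because the subgradients xi_k are
   bounded, so g(y^k) is bounded above.  Since p_k and d_k tend to 0, xi_k tends
   to A x along subsequences with x^k -> x, and the graph of the subdifferential
   of g is closed.

   The properness of g, without which the prox step carries no information,
   amounts to the existence of an affine minorant of h. *)

(** * Inner product algebra, with the Young and Cauchy-Schwarz inequalities *)

Section InnerProduct.
Context {R : realType} {V : euclideanType R}.
Implicit Types (u v w : V) (t : R).

Lemma dotvDr u v w : '[u, v + w] = '[u, v] + '[u, w].
Proof. by rewrite dotvC dotvDl !(dotvC u). Qed.

Lemma dotvZr t u v : '[u, t *: v] = t * '[u, v].
Proof. by rewrite dotvC dotvZl dotvC. Qed.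

Lemma dotvNl u v : '[- u, v] = - '[u, v].
Proof. by rewrite -scaleN1r dotvZl mulN1r. Qed.

Lemma dotvNr u v : '[u, - v] = - '[u, v].
Proof. by rewrite dotvC dotvNl dotvC. Qed.

Lemma dotvBl u v w : '[u - v, w] = '[u, w] - '[v, w].
Proof. by rewrite dotvDl dotvNl. Qed.

Lemma dotvBr u v w : '[u, v - w] = '[u, v] - '[u, w].
Proof. by rewrite dotvDr dotvNr. Qed.

Lemma dot0v u : '[0, u] = 0.
Proof. by rewrite -(scale0r 0) dotvZl mul0r. Qed.

Lemma dotv0 u : '[u, 0] = 0.
Proof. by rewrite dotvC dot0v. Qed.

Lemma dotv_suml (I : Type) (s : seq I) (F : I -> V) u :
  '[\sum_(i <- s) F i, u] = \sum_(i <- s) '[F i, u].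
Proof.
by elim/big_rec2: _ => [|i y1 y2 _ <-]; rewrite ?dot0v// dotvDl.
Qed.

Lemma dotv_eq0 u : '[u, u] = 0 -> u = 0.
Proof. by rewrite dotvv => /eqP; rewrite sqrf_eq0 normr_eq0 => /eqP. Qed.

Lemma sqr_normvD u v : `|u + v| ^+ 2 = `|u| ^+ 2 + 2 * '[u, v] + `|v| ^+ 2.
Proof. by rewrite -!dotvv dotvDl !dotvDr (dotvC v u); ring. Qed.

(** Expand |t u - v|^2 >= 0 and divide by 2t. *)
Lemma dotv_young t u v : 0 < t ->
  '[u, v] <= t / 2 * `|u| ^+ 2 + (2 * t)^-1 * `|v| ^+ 2.
Proof.
move=> t0; have := sqr_ge0 `|t *: u - v|.
rewrite sqr_normvD normrN dotvNr dotvZl normrZ exprMn real_normK ?num_real//.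
move=> h; rewrite -(ler_pM2l t0) -subr_ge0.
have -> : t * (t / 2 * `|u| ^+ 2 + (2 * t)^-1 * `|v| ^+ 2) - t * '[u, v] =
  2^-1 * (t ^+ 2 * `|u| ^+ 2 + 2 * - (t * '[u, v]) + `|v| ^+ 2).
  by field; rewrite gt_eqF.
by rewrite mulr_ge0.
Qed.

Lemma dotv_le_norm u v : '[u, v] <= `|u| * `|v|.
Proof.
have [->|u0] := eqVneq u 0; first by rewrite dot0v normr0 mul0r.
have [->|v0] := eqVneq v 0; first by rewrite dotv0 normr0 mulr0.
have nu : 0 < `|u| by rewrite normr_gt0.
have nv : 0 < `|v| by rewrite normr_gt0.
(* With this weight both terms of Young's bound equal |u| |v| / 2. *)
have := @dotv_young (`|v| / `|u|) u v (divr_gt0 nv nu).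
move/le_trans; apply; rewrite le_eqVlt; apply/orP; left; apply/eqP.
by field; rewrite !gt_eqF.
Qed.

Lemma normr_dotv_le u v : `|'[u, v]| <= `|u| * `|v|.
Proof.
by rewrite ler_norml dotv_le_norm andbT lerNl -dotvNl -(normrN u) dotv_le_norm.
Qed.

Lemma cvg_dotv (T : Type) (F : set_system T) (FF : Filter F) (u_ v_ : T -> V)
    u v :
  u_ @ F --> u -> v_ @ F --> v -> '[u_ i, v_ i] @[i --> F] --> '[u, v].
Proof.
move=> cu cv; apply/subr_cvg0/norm_cvg0P.
pose b i := `|u_ i - u| * `|v_ i| + `|u| * `|v_ i - v|.
have bE : b @ F --> (0 : R).
  rewrite [X in _ --> X](_ : _ = 0 * `|v| + `|u| * 0); last by ring.
  apply: cvgD; apply: cvgM.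
  - by apply/norm_cvg0P/subr_cvg0.
  - exact: cvg_norm.
  - exact: cvg_cst.
  - by apply/norm_cvg0P/subr_cvg0.
apply: (squeeze_cvgr _ (cvg_cst 0) bE); apply: nearW => i; rewrite normr_ge0/=.
have -> : '[u_ i, v_ i] - '[u, v] = '[u_ i - u, v_ i] + '[u, v_ i - v].
  by rewrite dotvBl dotvBr; ring.
by rewrite (le_trans (ler_normD _ _))// lerD// normr_dotv_le.
Qed.

End InnerProduct.

(** * Expansion of vectors in a finite frame *)

Section FiniteDimension.
Context {R : realType} {V : euclideanType R}.

(** The products of u with a basis [e] determine u, since a vector orthogonal to a basis is zero;
    [d i] is the image of the i-th unit row under a left inverse of this coordinate map. *)
Lemma exists_dual_frame : exists n (e d : 'I_n -> V),
  forall u, u = \sum_i '[u, e i] *: d i.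
Proof.
pose n := \dim (fullv : {vspace V}); pose e := vbasis (fullv : {vspace V}).
pose T (u : V) : 'rV[R]_n := \row_j '[u, e`_j].
have T_lin : linear T.
  by move=> t u v; apply/rowP => j; rewrite !mxE dotvDl dotvZl.
pose T' : {linear V -> 'rV[R]_n} :=
  HB.pack T (GRing.isLinear.Build _ _ _ _ T T_lin).
have kerT : lker (linfun T') == 0%VS.
  apply/lker0P => u v; rewrite !lfunE => /rowP Tuv.
  suff uv_eq0 w : '[u - v, w] = 0 by apply/subr0_eq/dotv_eq0.
  rewrite (coord_vbasis (memvf w)) dotvC dotv_suml big1// => i _.
  have := Tuv i; rewrite !mxE => Tuvi.
  by rewrite dotvZl dotvC dotvBl Tuvi subrr mulr0.
exists n, (fun i => e`_i), (fun i => (linfun T')^-1%VF (delta_mx 0 i)) => u.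
rewrite -[LHS](lker0_lfunK kerT) lfunE/= [T u]row_sum_delta linear_sum.
by apply: eq_bigr => i _; rewrite linearZ/= mxE.
Qed.

End FiniteDimension.

(** * Boundedness of linear maps and compactness of balls *)

Section FiniteDimensionalTopology.
Context {R : realType} {V : euclideanType R}.

Lemma linear_le_norm (W : normedModType R) (f : {linear V -> W}) :
  exists2 K : R, 0 < K & forall u, `|f u| <= K * `|u|.
Proof.
have [n [e [d ed]]] := @exists_dual_frame R V.
pose K := \sum_i `|e i| * `|f (d i)|.
have K0 : 0 <= K by apply: sumr_ge0 => i _; rewrite mulr_ge0.
exists (1 + K) => [|u]; first by rewrite ltr_wpDr.
rewrite {1}(ed u) linear_sum (le_trans (ler_norm_sum _ _ _))//.
rewrite (@le_trans _ _ (K * `|u|))//; last first.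
  by rewrite ler_wpM2r// lerDr.
rewrite mulr_suml; apply: ler_sum => i _.
rewrite linearZ/= normrZ mulrAC ler_wpM2r// mulrC; exact: normr_dotv_le.
Qed.

Lemma linear_cvg (W : normedModType R) (f : {linear V -> W}) (T : Type)
    (F : set_system T) (FF : Filter F) (u_ : T -> V) (u : V) :
  u_ @ F --> u -> f (u_ i) @[i --> F] --> f u.
Proof.
have [K K0 fK] := linear_le_norm f.
move=> /subr_cvg0/norm_cvg0P cu; apply/subr_cvg0/norm_cvg0P.
have bE : K * `|u_ i - u| @[i --> F] --> (0 : R).
  by rewrite -(mulr0 K); apply: cvgM => //; exact: cvg_cst.
apply: (squeeze_cvgr _ (cvg_cst 0) bE); apply: nearW => i; rewrite normr_ge0/=.
by rewrite -raddfB; exact: fK.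
Qed.

(** By the frame expansion the ball is a closed subset of the continuous image of a box of
    coefficients. *)
Lemma compact_closed_ball_norm (r : R) : compact [set u : V | `|u| <= r].
Proof.
have [n [e [d ed]]] := @exists_dual_frame R V.
pose K := \sum_i `|e i|.
have K0 : 0 <= K by apply: sumr_ge0 => i _.
pose phi (a : 'rV[R]_n) : V := \sum_i a 0 i *: d i.
have phi_cont : continuous phi.
  move=> a; have Fa := nbhs_filter a; rewrite /phi.
  apply: cvg_big => [|i _]; first exact: add_continuous.
  by apply: cvgZ; [exact: coord_continuous|exact: cvg_cst].
pose B := [set a : 'rV[R]_n | forall i, `[- (K * r), K * r]%classic (a 0 i)].
have cB : compact (phi @` B).
  apply: continuous_compact; first exact: continuous_subspaceT.
  have := @rV_compact R n (fun _ => `[- (K * r), K * r]%classic).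
  by apply => i; exact: segment_compact.
apply: (subclosed_compact _ cB).
- rewrite (_ : [set u | _] = (fun u : V => `|u|) @^-1` [set x : R | x <= r])//.
  by apply: closed_comp; [move=> u _; exact: norm_continuous|exact: closed_le].
- move=> u /= ur; exists (\row_i '[u, e i]); last first.
    by rewrite /phi [RHS]ed; apply: eq_bigr => i _; rewrite mxE.
  move=> i; rewrite /= in_itv/= mxE -ler_norml (le_trans (normr_dotv_le _ _))//.
  rewrite mulrC ler_pM// /K (bigD1 i)//= lerDl; exact: sumr_ge0.
Qed.

End FiniteDimensionalTopology.

(** * Invertibility of M and a lower bound for the adjoint *)

Section Adjoint.
Context {R : realType} {X Y : euclideanType R}.
Variables (A : 'Hom(X, Y)) (At : 'Hom(Y, X)).
Hypotheses (A_adj : is_adjoint A At) (A_surj : forall v, exists u, A u = v).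

Lemma adjoint_surj_eq0 v : A (At v) = 0 -> v = 0.
Proof.
move=> AAtv; have [u uv] := A_surj v.
have Atv : At v = 0 by apply: dotv_eq0; rewrite -A_adj AAtv dot0v.
by apply: dotv_eq0; rewrite -{1}uv A_adj Atv dotv0.
Qed.

Variable alpha : R.
Hypothesis alpha_gt0 : 0 < alpha.

Let M := ppdg_metric A At alpha.

Lemma ppdg_metricE v : M v = alpha *: A (At v).
Proof. by rewrite /M /ppdg_metric scale_lfunE comp_lfunE. Qed.

Lemma ppdg_metric_sym u v : '[M u, v] = '[M v, u].
Proof.
rewrite !ppdg_metricE !dotvZl !A_adj; congr (_ * _); exact: dotvC.
Qed.

Lemma lker_ppdg_metric : lker M == 0%VS.
Proof.
apply/lker0P => u v /eqP; rewrite -subr_eq0 -linearB/= ppdg_metricE.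
rewrite scaler_eq0 gt_eqF//= => /eqP /adjoint_surj_eq0; exact: subr0_eq.
Qed.

Lemma ppdg_metricK : cancel M^-1%VF M.
Proof. exact: lker0_lfunVK lker_ppdg_metric. Qed.

(** Write v = M^-1 (alpha A A^T v). This recovers dual increments from their images under A^T, which
    the primal step controls. *)
Lemma adjoint_norm_ge : exists2 K, 0 < K & forall v, `|v| <= K * `|At v|.
Proof.
have [K1 K10 MK] := linear_le_norm (M^-1)%VF.
have [K2 K20 AK] := linear_le_norm A.
exists (K1 * (alpha * K2)) => [|v]; first by rewrite !mulr_gt0.
rewrite -{1}(lker0_lfunK lker_ppdg_metric v) (le_trans (MK _))//.
rewrite -mulrA ler_pM2l// ppdg_metricE normrZ gtr0_norm// -mulrA ler_pM2l//.
exact: AK.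
Qed.

End Adjoint.

(** * Affine minorants of convex subsets of Y x R *)

Section AffineMinorant.
Context {R : realType} {Y : euclideanType R}.
Implicit Types (E : Y -> R -> Prop) (N : {vspace Y}).

(** Subsets of Y x R are relations between a point and a height, so that slicing by a hyperplane is
    a conjunction. *)
Definition convex_rel E :=
  forall l u1 t1 u2 t2, 0 < l -> l < 1 -> E u1 t1 -> E u2 t2 ->
  E (l *: u1 + (1 - l) *: u2) (l * t1 + (1 - l) * t2).

Definition vertically_bounded E :=
  forall u, exists m, forall t, E u t -> m <= t.

Definition has_affine_minorant E :=
  exists v c, forall u t, E u t -> '[v, u] + c <= t.

(** [D] is the excess over the minorant of the slice. A segment joining the two sides crosses the
    slice, where the excess is nonnegative; hence every slope of [D] on the left is at most every
    slope on the right, and tilting the minorant by the supremum [tau] of the left slopes works on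
    both sides. *)
Lemma affine_minorant_from_slice E n u1 t1 u2 t2 : convex_rel E ->
  E u1 t1 -> E u2 t2 -> forall s, '[n, u1] < s < '[n, u2] ->
  has_affine_minorant (fun u t => E u t /\ '[n, u] = s) ->
  has_affine_minorant E.
Proof.
move=> Ec E1 E2 s /andP[u1s su2] [v [c vc]].
pose D (u : Y) t := t - '[v, u] - c.
have slope u t u' t' : E u t -> '[n, u] < s -> E u' t' -> s < '[n, u'] ->
    D u t / ('[n, u] - s) <= D u' t' / ('[n, u'] - s).
  move=> Eut us Eut' us'.
  set a := '[n, u] - s; set b := '[n, u'] - s.
  have a0 : a < 0 by rewrite subr_lt0.
  have b0 : 0 < b by rewrite subr_gt0.
  have ba : 0 < b - a by rewrite subr_gt0 (lt_trans a0).
  (* This weight puts the convex combination on the hyperplane at level [s]. *)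
  pose l := b / (b - a).
  have l0 : 0 < l by rewrite divr_gt0.
  have l1 : l < 1 by rewrite ltr_pdivrMr// mul1r ltrDl oppr_gt0.
  have {vc} := vc _ _ (conj (Ec _ _ _ _ _ l0 l1 Eut Eut') _).
  have ua : '[n, u] = a + s by rewrite /a subrK.
  have ub : '[n, u'] = b + s by rewrite /b subrK.
  rewrite !(dotvDr, dotvZr) ua ub.
  have -> : l * (a + s) + (1 - l) * (b + s) = s.
    by rewrite /l; field; rewrite gt_eqF.
  move=> /(_ erefl); rewrite -subr_ge0.
  have -> : l * t + (1 - l) * t' - (l * '[v, u] + (1 - l) * '[v, u'] + c) =
    (b * D u t - a * D u' t') / (b - a).
    by rewrite /l /D; field; rewrite gt_eqF.
  rewrite pmulr_lge0 ?invr_gt0// subr_ge0 => h.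
  by rewrite ler_pdivlMr// mulrAC ler_ndivrMr// mulrC [leRHS]mulrC.
pose S := [set r | exists u t,
  [/\ E u t, '[n, u] < s & r = D u t / ('[n, u] - s)]].
have S0 : S !=set0 by exists (D u1 t1 / ('[n, u1] - s)), u1, t1.
have Sub : has_ubound S.
  exists (D u2 t2 / ('[n, u2] - s)) => _ [u [t [Eut us ->]]]; exact: slope.
pose tau := sup S.
exists (v + tau *: n), (c - tau * s) => u t Eut.
suff : tau * ('[n, u] - s) <= D u t.
  by rewrite /D dotvDl dotvZl => h; lra.
have [us|us|us] := ltgtP '[n, u] s.
- rewrite -ler_ndivrMr ?subr_lt0//; apply: ub_le_sup => //.
  by exists u, t.
- rewrite -ler_pdivlMr ?subr_gt0//; apply: ge_sup => //.
  by move=> _ [u' [t' [Eut' us' ->]]]; exact: slope.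
- by have := vc _ _ (conj Eut us); rewrite us subrr mulr0 /D => h; lra.
Qed.

(* Induction on the codimension of a space [N] of directions along which the
   projection of [E] is constant: a direction [n] along which it is not
   constant is eliminated by slicing [E] strictly between two values of
   ['[n, _]], so that the minorant of the slice extends to both sides. *)
Lemma convex_affine_minorant E : convex_rel E ->
  (exists u t, E u t) -> vertically_bounded E -> has_affine_minorant E.
Proof.
move=> Ec E0 Ev.
have : exists N, forall n, n \in N ->
    forall u1 t1 u2 t2, E u1 t1 -> E u2 t2 -> '[n, u1] = '[n, u2].
  by exists 0%VS => n; rewrite memv0 => /eqP-> *; rewrite !dot0v.
move=> [N]; have := leq_addr (\dim N) (\dim {:Y}).
move: {2}(\dim {:Y}) => k; elim: k => [|k IHk] in N E Ec E0 Ev * => dimN NE.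
  (* In codimension 0 all of [E] lies over the single point [u0], and its vertical bound there is a
     constant minorant. *)
  have [u0 [t0 E00]] := E0; have [m mE] := Ev u0; exists 0, m => u t Eut.
  suff uu0 : u = u0 by rewrite dot0v add0r; apply: (mE t); rewrite -uu0.
  apply/subr0_eq/dotv_eq0; rewrite dotvBr (NE _ _ _ _ _ _ Eut E00) ?subrr//.
  suff -> : N = fullv by exact: memvf.
  by apply/eqP; rewrite eqEdim subvf.
(* Swapping the two points turns this inequality into equality; its failure supplies the strict
   inequality needed for slicing. *)
have [cst|] := pselect (forall n u1 t1 u2 t2, E u1 t1 -> E u2 t2 ->
    '[n, u1] <= '[n, u2]).
  apply: (IHk fullv) => //; first exact: leq_addl.
  move=> n _ u1 t1 u2 t2 E1 E2.
  by apply/eqP; rewrite eq_le (cst _ _ _ _ _ E1 E2) (cst _ _ _ _ _ E2 E1).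
move=> /existsNP[n /existsNP[u2 /existsNP[t2 /existsNP[u1 /existsNP[t1]]]]].
move=> /not_implyP[E2 /not_implyP[E1 /negP]]; rewrite -ltNge => u12.
pose s := 2^-1 * '[n, u1] + (1 - 2^-1) * '[n, u2].
have s12 : '[n, u1] < s < '[n, u2] by rewrite /s; apply/andP; split; lra.
apply: (affine_minorant_from_slice Ec E1 E2 s12).
have nN : n \notin N.
  by apply/negP => /NE/(_ _ _ _ _ E1 E2) u12E; rewrite u12E ltxx in u12.
apply: (IHk (N + <[n]>)%VS).
- move=> l u t u' t' l0 l1 [Eut us] [Eut' us']; split; first exact: Ec.
  by rewrite dotvDr !dotvZr us us'; ring.
- exists (2^-1 *: u1 + (1 - 2^-1) *: u2), (2^-1 * t1 + (1 - 2^-1) * t2).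
  split; last by rewrite dotvDr !dotvZr.
  by apply: Ec => //; lra.
- by move=> u; have [m mE] := Ev u; exists m => t [/mE].
- rewrite (leq_trans dimN)// addSnnS leq_add2l.
  rewrite ltn_neqAle dimvS ?addvSl// andbT; apply: contra nN => /eqP NnN.
  have : (N == N + <[n]>)%VS by rewrite eqEdim addvSl NnN leqnn.
  by move=> /eqP ->; apply: (subvP (addvSr N _)); exact: memv_line.
- move=> w /memv_addP[w1 w1N [w2 /vlineP[b ->] ->]] u t u' t' [Eut us] [Eut' us'].
  by rewrite !dotvDl !dotvZl us us' (NE _ w1N _ _ _ _ Eut Eut').
Qed.

End AffineMinorant.

(** * The conjugate: properness, convexity, subgradients and the prox step *)

Section Conjugate.
Context {R : realType} {Y : euclideanType R}.
Variable h : Y -> \bar R.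
Hypothesis h_gtNy : forall u, (-oo < h u)%E.
Hypothesis hull_proper : proper_efun (convex_hull_fun h).

(** Otherwise the epigraph is empty, hence convex, and the convex hull of [h] is +oo everywhere. *)
Lemma proper_hull_dom : exists u, (h u < +oo)%E.
Proof.
apply: contrapT => /forallNP h_oo; have [_ [u]] := hull_proper.
apply/negP; rewrite -leNgt; apply/ereal_infP => _ [t /= Et <-].
suff : @set0 (Y * R^o)%type (u, t) by [].
apply: Et; split => [p q l|]; first by rewrite inE.
move=> [v s] /= hvs; apply: (h_oo v); exact: le_lt_trans hvs (ltry _).
Qed.

Lemma proper_hull_affine_minorant :
  exists v c, forall u, (('[v, u] + c)%:E <= h u)%E.
Proof.
pose E u t := smallest (@convex_set R (Y * R^o)%type) (epigraph h) (u, t).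
have [|||v [c vc]] := @convex_affine_minorant R Y E.
- move=> l u1 t1 u2 t2 l0 l1 E1 E2 B [B_conv hB].
  have l01 : 0 <= l <= 1 by rewrite !ltW.
  have := B_conv (u1, t1) (u2, t2) (Itv01 (ltW l0) (ltW l1)).
  rewrite !inE; apply; [exact: E1|exact: E2].
- have [u hu] := proper_hull_dom; exists u, (fine (h u)) => B [_]; apply => /=.
  by rewrite /epigraph/= fineK// fin_real// h_gtNy.
(* The hull function never takes the value -oo, so each nonempty fibre is bounded below by its
   finite value; for an empty fibre the bound 0 is arbitrary. *)
- move=> u; have [/(_ u) hull_u _] := hull_proper.
  have [Eu0|Eu] := pselect (exists t, E u t); last first.
    by exists 0 => t Eut; exfalso; apply: Eu; exists t.
  have [t0 Et0] := Eu0.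
  have hull_t t : E u t -> (convex_hull_fun h u <= t%:E)%E.
    by move=> Eut; apply: ereal_inf_lbound; exists t.
  exists (fine (convex_hull_fun h u)) => t Eut.
  rewrite -lee_fin fineK ?hull_t// fin_real// hull_u/=.
  exact: le_lt_trans (hull_t _ Et0) (ltry _).
- exists v, c => u.
  have [hu|] := boolP (h u < +oo)%E; last first.
    by rewrite -leNgt leye_eq => /eqP->; rewrite leey.
  have hfin : h u \is a fin_num by rewrite fin_real// h_gtNy.
  rewrite -(fineK hfin) lee_fin; apply: vc => B [_]; apply => /=.
  by rewrite /epigraph/= fineK.
Qed.

Local Notation g := (fenchel_conj h).

(** Turns bounds on g into affine real inequalities in y, one for each u in the domain of [h];
    convexity and closedness arguments for g then go through for each fixed u. *)
Lemma fenchel_conj_leP y (c : R) : (g y <= c%:E)%E <->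
  forall u, (h u < +oo)%E -> '[y, u] - fine (h u) <= c.
Proof.
split=> [gyc u hu|yc].
  have hfin : h u \is a fin_num by rewrite fin_real// h_gtNy.
  rewrite -lee_fin EFinB fineK//; apply: le_trans gyc.
  by apply: ereal_sup_ubound; exists u.
apply/ereal_supP => _ [u _ <-].
have [hu|] := boolP (h u < +oo)%E; last first.
  by rewrite -leNgt leye_eq => /eqP->; rewrite addeNy leNye.
have hfin : h u \is a fin_num by rewrite fin_real// h_gtNy.
by rewrite -(fineK hfin) -EFinB lee_fin; exact: yc.
Qed.

Lemma fenchel_conj_gtNy y : (-oo < g y)%E.
Proof.
have [u hu] := proper_hull_dom.
have hfin : h u \is a fin_num by rewrite fin_real// h_gtNy.
apply: (@lt_le_trans _ _ ('[y, u] - fine (h u))%:E); first exact: ltNyr.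
by rewrite EFinB fineK//; apply: ereal_sup_ubound; exists u.
Qed.

Lemma fenchel_conj_fin_num y : (g y < +oo)%E -> g y \is a fin_num.
Proof. by move=> gy; rewrite fin_real// fenchel_conj_gtNy. Qed.

Lemma fenchel_conj_proper : exists y, g y \is a fin_num.
Proof.
have [v [c vc]] := proper_hull_affine_minorant.
exists v; apply: fenchel_conj_fin_num.
apply: (@le_lt_trans _ _ (- c)%:E); last exact: ltry.
apply/fenchel_conj_leP => u hu.
have hfin : h u \is a fin_num by rewrite fin_real// h_gtNy.
have := vc u; rewrite -{1}(fineK hfin) lee_fin => ?; lra.
Qed.

Lemma fenchel_conj_convex y z (t : R) : g y \is a fin_num -> g z \is a fin_num ->
  0 <= t <= 1 ->
  (g (y + t *: (z - y))%R <= ((1 - t) * fine (g y) + t * fine (g z))%:E)%E.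
Proof.
move=> gy gz /andP[t0 t1]; apply/fenchel_conj_leP => u hu.
have /fenchel_conj_leP/(_ u hu) gyu : (g y <= (fine (g y))%:E)%E by rewrite fineK.
have /fenchel_conj_leP/(_ u hu) gzu : (g z <= (fine (g z))%:E)%E by rewrite fineK.
rewrite dotvDl dotvZl dotvBl.
have -> : '[y, u] + t * ('[z, u] - '[y, u]) - fine (h u) =
  (1 - t) * ('[y, u] - fine (h u)) + t * ('[z, u] - fine (h u)) by ring.
by rewrite lerD// ler_wpM2l// subr_ge0.
Qed.

Lemma subdiff_fenchel_conjP y v : subdiff g y v <->
  g y \is a fin_num /\
  forall z, g z \is a fin_num -> fine (g y) + '[v, z - y] <= fine (g z).
Proof.
split=> -[gy yv]; split=> // z.
  by move=> gz; rewrite -lee_fin EFinD !fineK.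
have [gz|] := boolP (g z < +oo)%E; last first.
  by rewrite -leNgt leye_eq => /eqP->; rewrite leey.
have gzf := fenchel_conj_fin_num gz.
by rewrite -(fineK gy) -(fineK gzf) -EFinD lee_fin; exact: yv.
Qed.

(** First-order optimality: compare y with y + t (z - y), use convexity of g, divide by t and make t
    small. *)
Lemma prox_subdiff (M : 'End(Y)) (w y : Y) :
  (forall u v, '[M u, v] = '[M v, u]) ->
  prox M g w y -> subdiff g y (M (w - y)).
Proof.
move=> M_sym y_min; pose q u := 2^-1 * '[M u, u].
have gy : g y \is a fin_num.
  (* An infinite value at the minimizer would make the objective infinite also at a point of the
     domain of g. *)
  have [y0 gy0] := fenchel_conj_proper; apply: fenchel_conj_fin_num.
  rewrite ltey; apply/negP => /eqP gy_oo; have := y_min y0.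
  by rewrite gy_oo addye// -(fineK gy0) -EFinD leye_eq.
apply/subdiff_fenchel_conjP; split=> // z gz.
set D := fine (g z) - fine (g y) + '[M (y - w), z - y].
have qD (t : R) : 0 < t <= 1 -> 0 <= D + t * q (z - y).
  move=> /andP[t0 t1].
  have t01 : 0 <= t <= 1 by rewrite ltW.
  have := le_trans (y_min (y + t *: (z - y)))
    (leeD2r _ (fenchel_conj_convex gy gz t01)).
  rewrite -(fineK gy) -!EFinD lee_fin -subr_ge0 => H.
  rewrite -(pmulr_rge0 _ t0); apply: le_trans H _.
  rewrite le_eqVlt; apply/orP; left.
  rewrite (_ : y + t *: (z - y) - w = (y - w) + t *: (z - y)); last first.
    by rewrite addrAC.
  rewrite /q /D; move: (y - w) (z - y) => a b.
  rewrite linearD linearZ/= !(dotvDl, dotvDr, dotvZl, dotvZr) (M_sym b a).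
  by apply/eqP; field.
have D0 : 0 <= D.
  rewrite leNgt; apply/negP => Dlt0.
  have [Q0|Q0] := leP (q (z - y)) 0.
    have := qD 1; rewrite ltr01 lexx mul1r => /(_ isT); lra.
  (* Chosen so that t q(z - y) <= -D/2, which leaves D + t q(z - y) <= D/2 < 0. *)
  pose t := Order.min 1 (- D / (2 * q (z - y))).
  have t0 : 0 < t by rewrite lt_min ltr01 divr_gt0 ?oppr_gt0// mulr_gt0.
  have t1 : t <= 1 by rewrite ge_min lexx.
  have := qD t; rewrite t0 t1 => /(_ isT).
  have : t * q (z - y) <= - D / 2.
    by rewrite -ler_pdivlMr// -mulrA -invfM ge_min lexx orbT.
  lra.
rewrite -(opprB y w) linearN/= dotvNl; move: D0; rewrite /D; lra.
Qed.

End Conjugate.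

(** * Quadratic upper bound for functions with Lipschitz gradient *)

Section DescentLemma.
Context {R : realType} {X : euclideanType R}.
Variables (f : X -> R) (gradf : X -> X) (L : R).
Hypothesis f_C1 : C1_with_gradient f gradf.
Hypothesis gradf_lip : forall u v, `|gradf u - gradf v| <= L * `|u - v|.

Lemma is_derive_line u v (t : R) :
  is_derive t 1 (fun s : R => f (u + s *: v)) '[gradf (u + t *: v), v].
Proof.
have [df dfE _] := f_C1.
have lineE : (fun s : R => s^-1 *: (((fun s => f (u + s *: v)) \o shift t)
      (s *: 1) - f (u + t *: v))) =
    (fun s : R => s^-1 *: ((f \o shift (u + t *: v)) (s *: v) - f (u + t *: v))).
  apply/funext => s /=; congr (_ *: (f _ - _)).
  by rewrite [s *: 1]mulr1 scalerDl addrCA.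
split; first by rewrite /derivable lineE; exact: diff_derivable.
by rewrite /derive lineE -dfE -deriveE.
Qed.

(** [psi] is f along the segment minus the quadratic model. Its derivative is nonpositive for t >= 0
    by Cauchy-Schwarz and the Lipschitz bound, so the mean value theorem gives psi(1) <= psi(0). *)
Lemma descent u v : f (u + v) <= f u + '[gradf u, v] + L / 2 * `|v| ^+ 2.
Proof.
pose psi (t : R) :=
  f (u + t *: v) - ('[gradf u, v] * t + L / 2 * `|v| ^+ 2 * t ^+ 2).
pose dpsi (t : R) :=
  '[gradf (u + t *: v), v] - ('[gradf u, v] + L * `|v| ^+ 2 * t).
have psi_der (t : R) : is_derive t 1 psi (dpsi t).
  pose a := '[gradf u, v]; pose b := L / 2 * `|v| ^+ 2.
  have -> : psi = (fun s => f (u + s *: v)) - (a \*: id + b \*: (id ^+ 2)) by [].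
  have line_der := is_derive_line u v t.
  apply: is_derive_eq.
  by rewrite /dpsi /a /b /GRing.scale/=; field.
have psi_cont : {within `[0, 1], continuous psi}.
  by apply: derivable_within_continuous => t _; have [] := psi_der t.
have [t] := MVT_segment ler01 (fun s _ => psi_der s) psi_cont.
rewrite in_itv/= => /andP[t0 _]; rewrite subr0 mulr1.
have : dpsi t <= 0.
  rewrite /dpsi opprD addrA -dotvBl subr_le0 (le_trans (dotv_le_norm _ _))//.
  rewrite (le_trans (ler_wpM2r _ (gradf_lip _ _)))//.
  by rewrite addrAC subrr add0r normrZ ger0_norm// expr2 -!mulrA [t * _]mulrC !mulrA.
move=> dpsi_le0 psiE; move: dpsi_le0; rewrite -psiE /psi.
rewrite scale1r scale0r addr0; lra.
Qed.

Lemma C1_cvg (T : Type) (F : set_system T) (FF : Filter F) (u_ : T -> X) u :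
  u_ @ F --> u -> f (u_ i) @[i --> F] --> f u.
Proof.
have [df _ _] := f_C1 => cu; apply: (continuous_cvg _ _ cu).
exact/differentiable_continuous/df.
Qed.

Lemma bounded_lower_bound (B : R) : 0 <= L ->
  exists m, forall u, `|u| <= B -> m <= f u.
Proof.
move=> L0; exists (f 0 - (`|gradf 0| + L * B) * B - L / 2 * B ^+ 2) => u uB.
have B0 : 0 <= B by exact: le_trans uB.
(* Stepping from u back to 0 bounds f(u) from below by f(0). *)
have := descent u (- u); rewrite subrr dotvNr normrN => h.
have : '[gradf u, - u] <= (`|gradf 0| + L * B) * B.
  rewrite (le_trans (dotv_le_norm _ _))// normrN ler_pM//.
  rewrite -[X in `|X|](subrK (gradf 0)) addrC (le_trans (ler_normD _ _))// lerD//.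
  by rewrite (le_trans (gradf_lip _ _))// subr0 ler_wpM2l.
have : L / 2 * `|u| ^+ 2 <= L / 2 * B ^+ 2.
  by rewrite ler_wpM2l ?divr_ge0// lerXn2r// nnegrE.
rewrite dotvNr; lra.
Qed.

End DescentLemma.

(** * Summability from a decreasing quantity *)

Section Sequences.
Context {R : realType}.

Lemma nneseries_lty (P : nat -> R) (c : R) : (forall k, 0 <= P k) ->
  (forall n, \sum_(1 <= k < n) P k <= c) ->
  (\sum_(1 <= k <oo) (P k)%:E < +oo)%E.
Proof.
move=> P0 Pc; apply: (@le_lt_trans _ _ c%:E); last exact: ltry.
apply: lime_le; first by apply: is_cvg_nneseries => n _ _; rewrite lee_fin.
by apply: nearW => n; rewrite sumEFin lee_fin.
Qed.

(** [V] is nonincreasing and bounded below, and P_(k+1) is at most (V_k - V_(k+1)) / c, which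
    telescopes. [P 0] is not controlled, so sums start at 1. *)
Lemma sufficient_decrease (V P : nat -> R) (c m : R) : 0 < c ->
  (forall k, 0 <= P k) -> (forall k, V k.+1 <= V k - c * P k.+1) ->
  (forall k, m <= V k) ->
  [/\ cvgn V, P k @[k --> \oo] --> 0 &
      exists b, forall n, \sum_(1 <= k < n) P k <= b].
Proof.
move=> c0 P0 VP mV.
have V_cvg : cvgn V.
  apply: nonincreasing_is_cvgn; last by exists m => _ [k _ <-].
  apply/nonincreasing_seqP => k; apply: le_trans (VP k) _.
  by rewrite gerBl mulr_ge0// ltW.
have PV k : P k.+1 <= c^-1 * (V k - V k.+1).
  by rewrite mulrC ler_pdivlMr//; have := VP k; lra.
split => //.
- rewrite -(cvg_shiftS P) /=.
  have dV : c^-1 * (V k - V k.+1) @[k --> \oo] --> 0.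
    rewrite -(mulr0 c^-1) -(subrr (limn V)); apply: cvgM; first exact: cvg_cst.
    by apply: cvgB => //; rewrite (cvg_shiftS V).
  by apply: (squeeze_cvgr _ (cvg_cst 0) dV); apply: nearW => k; rewrite P0 PV.
- exists (c^-1 * (V 0 - m)) => -[|n].
    rewrite big_geq//; apply: mulr_ge0; first by rewrite invr_ge0 ltW.
    by rewrite subr_ge0.
  rewrite big_add1/=; apply: (@le_trans _ _ (c^-1 * (V 0 - V n))); last first.
    by rewrite ler_pM2l ?invr_gt0// lerB.
  elim: n => [|n IHn]; first by rewrite big_geq// subrr mulr0.
  by rewrite big_nat_recr//=; have := PV n; lra.
Qed.

End Sequences.

(** * Cluster sets, subsequences and distance to the cluster set *)

Section ClusterPoints.
Context {R : realType}.

Lemma cluster_set_compact (T : topologicalType) (F : set_system T) (K : set T) :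
  ProperFilter F -> compact K -> closed K -> F K ->
  cluster F !=set0 /\ compact (cluster F).
Proof.
move=> FF cK clK FK; have clF : cluster F `<=` K.
  move=> t; rewrite clusterE => /(_ _ FK); rewrite -(closure_id K).1//.
split; first by have [t [_ tF]] := cK _ FF FK; exists t.
apply: (subclosed_compact _ cK clF).
by rewrite clusterE; apply: closed_bigI => A _; exact: closed_closure.
Qed.

(** If [U] is not in [F], the trace of [F] on the complement of [U] is proper and has a cluster
    point in [K]. That point also clusters [F], so [U] is a neighbourhood of it that misses the
    trace. *)
Lemma near_cluster_set (T : topologicalType) (F : set_system T) (K U : set T) :
  ProperFilter F -> compact K -> F K -> (forall t, cluster F t -> nbhs t U) ->
  F U.
Proof.
move=> FF cK FK FU; apply: contrapT => nFU.
have GF : ProperFilter (within (~` U) F).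
  apply: Build_ProperFilter_ex => A wA; apply: contrapT => nA; apply: nFU.
  move: wA; rewrite /within/=; apply: filterS => t /= tA; apply: contrapT => tU.
  by apply: nA; exists t; exact: tA.
have [t [_ tG]] : K `&` cluster (within (~` U) F) !=set0.
  by apply: cK; apply: filterS FK => t.
have Ut : nbhs t U.
  apply: FU => A B FA tB; apply: tG => //; exact: filterS FA.
have wU : within (~` U) F (~` U) by rewrite /within/=; apply: nearW.
by have [s []] := tG _ _ wU Ut.
Qed.

Lemma cluster_subseq (V W : normedModType R) (u : nat -> V) (v : nat -> W) a b :
  cluster ((fun k => (u k, v k)) @ \oo) (a, b) ->
  exists phi : nat -> nat, [/\ forall j, (j <= phi j)%N,
    u (phi j).+1 @[j --> \oo] --> a & v (phi j).+1 @[j --> \oo] --> b].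
Proof.
move=> cl; have sel (j : nat) : exists k, (j <= k)%N /\
    (`|u k.+1 - a| < harmonic j /\ `|v k.+1 - b| < harmonic j).
  have j0 : 0 < harmonic j :> R by exact: harmonic_gt0.
  have [|_ [[k /= jk <-] []]] :=
    cl [set p | exists2 k, (j < k)%N & (u k, v k) = p] _ _ (nbhsx_ballx (a, b) _ j0).
    by exists j.+1 => // k /= jk; exists k.
  (* The tail starts at j + 1, so the index is a successor; the shift matches the quantities of the
     iteration, which live at k + 1. *)
  case: k jk => // k jk; rewrite -!ball_normE /= => uk vk.
  by exists k; rewrite distrC uk distrC vk.
have [phi phiP] := choice sel; exists phi.
have inv0 := @cvg_harmonic R.
split=> [j||]; first by have [] := phiP j.
- apply/subr_cvg0/norm_cvg0P; apply: (squeeze_cvgr _ (cvg_cst 0) inv0).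
  by apply: nearW => j; have [_ [/ltW ? _]] := phiP j; apply/andP.
- apply/subr_cvg0/norm_cvg0P; apply: (squeeze_cvgr _ (cvg_cst 0) inv0).
  by apply: nearW => j; have [_ [_ /ltW ?]] := phiP j; apply/andP.
Qed.

Lemma cvg_subseq (T : Type) (F : set_system T) (u : nat -> T) (phi : nat -> nat) :
  (forall j, (j <= phi j)%N) -> u @ \oo --> F -> u (phi j) @[j --> \oo] --> F.
Proof.
move=> phi_ge cu A /cu[N _ NA]; exists N => // j /= Nj; apply: NA.
exact: leq_trans (phi_ge j).
Qed.

Lemma dist_to_cluster_cvg (X Y : euclideanType R) (u : nat -> X) (v : nat -> Y)
    (B : R) : (forall k, `|u k| <= B) -> (forall k, `|v k| <= B) ->
  let C := cluster ((fun k => (u k, v k)) @ \oo) in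
  [/\ C !=set0, compact C & dist_to C (u k, v k) @[k --> \oo] --> 0%E].
Proof.
move=> uB vB C.
pose K : set (X * Y) := [set a | `|a| <= B] `*` [set b | `|b| <= B].
have cK : compact K by apply: compact_setX; exact: compact_closed_ball_norm.
have clK : closed K by apply: compact_closed => //; exact: norm_hausdorff.
have FK : ((fun k => (u k, v k)) @ \oo) K.
  by exists 0 => // k _; split => /=.
have [C0 cC] := cluster_set_compact _ cK clK FK.
split=> //; have dist_ge0 p : (0 <= dist_to C p)%E.
  by apply/ereal_infP => _ [q _ <-]; rewrite lee_fin sqrtr_ge0.
have near_dist (e : R) : 0 < e ->
    \forall k \near \oo, (dist_to C (u k, v k) <= e%:E)%E.
  move=> e0; pose d := e / 2; have d0 : 0 < d by rewrite divr_gt0.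
  have := @near_cluster_set _ _ K [set p | (dist_to C p <= e%:E)%E] _ cK FK.
  apply => q Cq; apply: filterS (nbhsx_ballx q _ d0) => p [].
  rewrite -!ball_normE/= => qp1 qp2.
  apply: ge_ereal_inf.
  exists (Num.sqrt (`|p.1 - q.1| ^+ 2 + `|p.2 - q.2| ^+ 2))%:E.
    by exists q.
  rewrite lee_fin -(ger0_norm (ltW e0)) -sqrtr_sqr ler_wsqrtr//.
  have sq (w : R) : 0 <= w -> w < d -> w ^+ 2 <= d ^+ 2.
    by move=> w0 /ltW wd; rewrite lerXn2r// nnegrE// ltW.
  have := sq _ (normr_ge0 _) qp1; have := sq _ (normr_ge0 _) qp2.
  have := sqr_ge0 e; rewrite (distrC p.1) (distrC p.2) /d expr_div_n; lra.
apply/fine_cvgP; split.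
  apply: filterS (near_dist 1 ltr01) => k dk.
  by rewrite ge0_fin_numE// (le_lt_trans dk)// ltry.
apply/cvgrPdist_le => e e0; apply: filterS (near_dist e e0) => k dk /=.
have dfin : dist_to C (u k, v k) \is a fin_num.
  by rewrite ge0_fin_numE// (le_lt_trans dk)// ltry.
by rewrite sub0r normrN ger0_norm ?fine_ge0// -lee_fin fineK.
Qed.

End ClusterPoints.

(** * Decrease along the iteration and the limits it forces *)

Section Convergence.
Context {R : realType} {X Y : euclideanType R}.
Variables (f : X -> R) (gradf : X -> X) (h : Y -> \bar R).
Variables (A : 'Hom(X, Y)) (At : 'Hom(Y, X)) (L alpha delta : R).
Variables (x : nat -> X) (y : nat -> Y).
Hypotheses (f_C1 : C1_with_gradient f gradf)
  (h_gtNy : forall u, (-oo < h u)%E)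
  (A_adj : is_adjoint A At) (L_gt0 : 0 < L)
  (gradf_lip : forall u v, `|gradf u - gradf v| <= L * `|u - v|)
  (A_surj : forall v, exists u, A u = v)
  (hull_proper : proper_efun (convex_hull_fun h))
  (alpha_gt0 : 0 < alpha) (delta_gt0 : 0 < delta)
  (c_gt0 : 0 < ppdg_c L alpha delta)
  (xy_ppdg : ppdg_iteration gradf A At h alpha x y).
Variable B : R.
Hypotheses (x_le : forall k, `|x k| <= B) (y_le : forall k, `|y k| <= B).

Local Notation g := (fenchel_conj h).

Let G v := fine (g v).
Let p k := x k.+1 - x k.
Let d k := gradf (x k.+1) - gradf (x k).
(* Eliminating [alpha A^T y^k] and [alpha A^T y^(k+1)] with the primal step, this
   is the subgradient [M (w - y^(k+1))] of the prox step at argument [w]. *)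
Let xi k := A (x k.+2 + alpha *: d k).
Let P k := `|p k| ^+ 2.
(** The index is shifted because y^0 may lie outside the domain of g, while every later dual iterate
    lies in it. *)
Let lag k := f (x k.+1) + '[y k.+1, A (x k.+1)] - G (y k.+1).
(* The correction terms absorb the [P k.+2] and [P k] of [dot_p_d_le], so that
   the coefficient of [P k.+1] in [V k.+1 - V k] collects to [- 2 c]. *)
Let V k := lag k - delta / alpha * P k.+1 + alpha * L ^+ 2 / (2 * delta) * P k.

Let d_le k : `|d k| <= L * `|p k|. Proof. exact: gradf_lip. Qed.

Let stepE k : alpha *: At (y k) = - p k - alpha *: gradf (x k).
Proof.
have [pE _] := xy_ppdg k.
by rewrite /p pE [x k - _]addrC addrK opprK scalerDr addrC addKr.
Qed.

Let dual_stepE k :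
  - (alpha *: At (y k.+1 - y k)) = p k.+1 - p k + alpha *: d k.
Proof.
by rewrite linearB/= scalerBr !stepE /d scalerBr !(opprD, opprK) addrACA.
Qed.

Let xi_subdiff k : subdiff g (y k.+1) (xi k).
Proof.
have [_ y_prox] := xy_ppdg k.
have M_sym := ppdg_metric_sym A_adj alpha.
have := prox_subdiff h_gtNy hull_proper M_sym y_prox; congr subdiff.
rewrite linearB linearD/= (ppdg_metricK A_adj A_surj alpha_gt0) !ppdg_metricE.
have AE j : alpha *: A (At (y j)) = A (- p j - alpha *: gradf (x j)).
  by rewrite -linearZ/= stepE.
rewrite !AE -linearD -linearB/=; congr (A _).
rewrite /d /p scalerBr scaler_nat mulr2n !(opprD, opprK).
(* Of the nine terms three pairs cancel; x^(k+2) and the two gradient terms remain. *)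
by rewrite (AC (3*3*3) ((7*(9*3))*(1*4)*(2*6)*(5*8)))/= addNr !subrr !addr0.
Qed.

Let y_dom k : g (y k.+1) \is a fin_num.
Proof. by have [] := xi_subdiff k. Qed.

Let xi_ineq k z : g z \is a fin_num ->
  G (y k.+1) + '[xi k, z - y k.+1] <= G z.
Proof.
have /(subdiff_fenchel_conjP h_gtNy hull_proper)[_] := xi_subdiff k; exact.
Qed.

(** Young with weight delta/alpha, then |d_j| <= L |p_j|, the triangle inequality and (r + s)^2 <= 2
    r^2 + 2 s^2 with s = (1 + alpha L) |p_(k+1)|. *)
Let dot_p_d_le k : '[p k.+2 - p k.+1 + alpha *: d k.+1, d k] <=
  delta / alpha * P k.+2 + (delta / alpha + 2 * delta * L + alpha * delta * L ^+ 2)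
    * P k.+1 + alpha * L ^+ 2 / (2 * delta) * P k.
Proof.
have t0 : 0 < delta / alpha by rewrite divr_gt0.
apply: le_trans (dotv_young _ _ t0) _.
have -> : delta / alpha * P k.+2 + (delta / alpha + 2 * delta * L +
    alpha * delta * L ^+ 2) * P k.+1 + alpha * L ^+ 2 / (2 * delta) * P k =
  delta / alpha / 2 * (2 * P k.+2 + 2 * ((1 + alpha * L) ^+ 2 * P k.+1)) +
  (2 * (delta / alpha))^-1 * (L ^+ 2 * P k).
  by field; rewrite !gt_eqF.
have aL : 0 < 1 + alpha * L by rewrite ltr_wpDr// mulr_ge0// ltW.
have T0 : 0 <= delta / alpha / 2 by rewrite divr_ge0// ltW.
have T1 : 0 <= (2 * (delta / alpha))^-1 by rewrite invr_ge0 mulr_ge0// ltW.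
apply: lerD; [apply: (ler_wpM2l T0)|apply: (ler_wpM2l T1)].
  have tri : `|p k.+2 - p k.+1 + alpha *: d k.+1| <=
      `|p k.+2| + (1 + alpha * L) * `|p k.+1|.
    rewrite -addrA (le_trans (ler_normD _ _))// lerD2l.
    rewrite (le_trans (ler_normD _ _))// normrN mulrDl mul1r lerD2l.
    by rewrite normrZ gtr0_norm// -mulrA ler_pM2l.
  have rhs0 : 0 <= `|p k.+2| + (1 + alpha * L) * `|p k.+1|.
    by rewrite addr_ge0// mulr_ge0// ltW.
  apply: (@le_trans _ _ ((`|p k.+2| + (1 + alpha * L) * `|p k.+1|) ^+ 2)).
    by rewrite lerXn2r// nnegrE.
  rewrite -exprMn /P; set r := (1 + _) * _.
  have := sqr_ge0 (`|p k.+2| - r); rewrite sqrrB sqrrD; lra.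
by rewrite -exprMn lerXn2r// nnegrE// mulr_ge0// ltW.
Qed.

Let lag_descent k : lag k.+1 <= lag k - (1 / alpha - L / 2) * P k.+1 +
  '[p k.+2 - p k.+1 + alpha *: d k.+1, d k].
Proof.
have xE : x k.+2 = x k.+1 + p k.+1 by rewrite /p addrC subrK.
have := descent f_C1 gradf_lip (x k.+1) (p k.+1); rewrite -xE.
have := xi_ineq k (y_dom k.+1).
have := stepE k.+1 => /(congr1 (fun w => '[w, p k.+1])).
rewrite dotvZl dotvBl dotvNl dotvv dotvZl => yp.
(* The primal step paired with p_(k+1); its gradient term cancels the one in the descent lemma. *)
have {yp} : '[y k.+1, A (p k.+1)] =
    - (1 / alpha) * P k.+1 - '[gradf (x k.+1), p k.+1].
  rewrite dotvC A_adj dotvC; apply: (mulfI (lt0r_neq0 alpha_gt0)).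
  by rewrite yp /P; field; rewrite gt_eqF.
(* By [dual_stepE] and adjointness both sides are the product of -alpha A d_k with the dual
   increment. *)
have : '[p k.+2 - p k.+1 + alpha *: d k.+1, d k] =
    '[y k.+2, A (x k.+2)] - '[y k.+1, A (x k.+2)] - '[xi k, y k.+2 - y k.+1].
  rewrite -dual_stepE dotvNl dotvZl -dotvZr dotvC -A_adj /xi [A (_ + alpha *: _)]linearD dotvDl.
  by rewrite (dotvC (A (x k.+2))) !dotvBl; ring.
have : '[y k.+1, A (x k.+2)] = '[y k.+1, A (x k.+1)] + '[y k.+1, A (p k.+1)].
  by rewrite {1}xE linearD dotvDr.
rewrite /lag -/(P k.+1); lra.
Qed.

Let V_descent k : V k.+1 <= V k - 2 * ppdg_c L alpha delta * P k.+1.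
Proof.
have := lag_descent k; have := dot_p_d_le k; rewrite /V.
have -> : 2 * ppdg_c L alpha delta = 1 / alpha - L / 2 - 2 * (delta / alpha)
    - alpha * delta * L ^+ 2 - 2 * delta * L - alpha * L ^+ 2 / (2 * delta).
  by rewrite /ppdg_c /ppdg_b; field; rewrite !gt_eqF.
lra.
Qed.

Let B_ge0 : 0 <= B. Proof. exact: le_trans (x_le 0). Qed.

Let p_le k : `|p k| <= 2 * B.
Proof.
by rewrite /p (le_trans (ler_normB _ _))// mulr_natl mulr2n lerD.
Qed.

Let V_lower_bound : exists m, forall k, m <= V k.
Proof.
have [K K0 AK] := linear_le_norm A.
have [m mf] := bounded_lower_bound f_C1 gradf_lip B (ltW L_gt0).
have [z gz] := fenchel_conj_proper h_gtNy hull_proper.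
(* Bounds every |xi_k|, since |x^k| <= B and |d_k| <= L |p_k| <= 2 L B. *)
pose Kxi := K * (B + alpha * (L * (2 * B))).
exists (m - B * (K * B) - (G z + Kxi * (B + `|z|))
  - delta / alpha * (2 * B) ^+ 2).
move=> k; rewrite /V /lag.
have f_ge : m <= f (x k.+1) by exact: mf.
have yAx_ge : - (B * (K * B)) <= '[y k.+1, A (x k.+1)].
  rewrite lerNl -dotvNl (le_trans (dotv_le_norm _ _))// normrN ler_pM//.
  by rewrite (le_trans (AK _))// ler_pM2l.
have xi_le : `|xi k| <= Kxi.
  rewrite (le_trans (AK _))// ler_pM2l// (le_trans (ler_normD _ _))// lerD//.
  rewrite normrZ gtr0_norm// ler_pM2l// (le_trans (d_le _))// ler_pM2l//.
(* The subgradient inequality tested at a fixed [z] of the domain bounds G from above. *)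
have G_le : G (y k.+1) <= G z + Kxi * (B + `|z|).
  have := xi_ineq k gz; rewrite -[z - _]opprB dotvNr.
  have : '[xi k, y k.+1 - z] <= Kxi * (B + `|z|); last by lra.
  rewrite (le_trans (dotv_le_norm _ _))// ler_pM//.
  by rewrite (le_trans (ler_normB _ _))// lerD2r.
have P_le : delta / alpha * P k.+1 <= delta / alpha * (2 * B) ^+ 2.
  by rewrite ler_pM2l ?divr_gt0// lerXn2r// nnegrE// mulr_ge0.
have : 0 <= alpha * L ^+ 2 / (2 * delta) * P k.
  by rewrite mulr_ge0 ?sqr_ge0// divr_ge0 ?mulr_ge0 ?sqr_ge0// ltW.
lra.
Qed.

Let V_cvg : [/\ cvgn V, P k @[k --> \oo] --> 0 &
  exists b, forall n, \sum_(1 <= k < n) P k <= b].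
Proof.
have [m mV] := V_lower_bound.
apply: (sufficient_decrease _ _ V_descent mV); first by rewrite mulr_gt0.
by move=> k; exact: sqr_ge0.
Qed.

Lemma ppdg_sum_x : (\sum_(1 <= k <oo) (`|x k.+1 - x k| ^+ 2)%:E < +oo)%E.
Proof.
have [_ _ [b Pb]] := V_cvg.
by apply: nneseries_lty Pb => k; exact: sqr_ge0.
Qed.

(** By [dual_stepE] and the lower bound for A^T, each dual increment is controlled by p_(k+1) and
    p_k. *)
Lemma ppdg_sum_y : (\sum_(1 <= k <oo) (`|y k.+1 - y k| ^+ 2)%:E < +oo)%E.
Proof.
have [_ _ [b Pb]] := V_cvg.
have [K K0 AtK] := adjoint_norm_ge A_adj A_surj alpha_gt0.
pose D := 2 * (K / alpha) ^+ 2; pose e := (1 + alpha * L) ^+ 2.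
have D0 : 0 <= D by rewrite mulr_ge0// sqr_ge0.
have dy k : `|y k.+1 - y k| ^+ 2 <= D * (P k.+1 + e * P k).
  pose r := `|p k.+1| + (1 + alpha * L) * `|p k|.
  have aL : 0 <= 1 + alpha * L by rewrite addr_ge0// mulr_ge0// ltW.
  have r0 : 0 <= r by rewrite addr_ge0// mulr_ge0.
  have yr : `|y k.+1 - y k| <= K / alpha * r.
    rewrite (le_trans (AtK _))// -mulrA ler_pM2l// mulrC ler_pdivlMr//.
    rewrite mulrC -{1}(gtr0_norm alpha_gt0) -normrZ -normrN dual_stepE.
    rewrite -addrA (le_trans (ler_normD _ _))// lerD2l.
    rewrite (le_trans (ler_normD _ _))// normrN mulrDl mul1r lerD2l.
    by rewrite normrZ gtr0_norm// -mulrA ler_pM2l.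
  have Kr0 : 0 <= K / alpha * r by rewrite mulr_ge0// divr_ge0// ltW.
  have : `|y k.+1 - y k| ^+ 2 <= (K / alpha * r) ^+ 2.
    by rewrite lerXn2r// nnegrE.
  move=> /le_trans; apply; rewrite exprMn /D [2 * _]mulrC -[leRHS]mulrA.
  rewrite ler_wpM2l ?sqr_ge0// /P /e -exprMn /r; set s := (1 + _) * _.
  have := sqr_ge0 (`|p k.+1| - s); rewrite sqrrB sqrrD; lra.
apply: (@nneseries_lty _ _ (D * (b + e * b))) => [k|n]; first exact: sqr_ge0.
apply: (@le_trans _ _ (\sum_(1 <= k < n) D * (P k.+1 + e * P k))).
  exact: ler_sum.
rewrite -mulr_sumr ler_wpM2l// big_split/= -mulr_sumr lerD//; last first.
  by rewrite ler_wpM2l// sqr_ge0.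
(* The sum of the P_(k+1) ends one index later, hence the bound at n + 1. *)
apply: le_trans (Pb n.+1); case: n => [|n]; first by rewrite !big_geq.
by rewrite [leRHS]big_ltn// [leRHS]addrC [X in _ <= X + _]big_add1/= lerDl sqr_ge0.
Qed.

Let p_cvg0 : p k @[k --> \oo] --> 0.
Proof.
have [_ P0 _] := V_cvg; apply/norm_cvg0P.
rewrite (_ : (fun k => `|p k|) = (fun k => Num.sqrt (P k))); last first.
  by apply/funext => k; rewrite sqrtr_sqr normr_id.
by rewrite -sqrtr0; apply: (continuous_cvg _ (@sqrt_continuous R 0) P0).
Qed.

Let d_cvg0 : d k @[k --> \oo] --> 0.
Proof.
have Lp : L * `|p k| @[k --> \oo] --> 0.
  by rewrite -(mulr0 L); apply: cvgM; [exact: cvg_cst|exact/norm_cvg0P].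
apply/norm_cvg0P; apply: (squeeze_cvgr _ (cvg_cst 0) Lp).
by apply: nearW => k; rewrite normr_ge0 d_le.
Qed.

(** The correction terms in [V] vanish in the limit. *)
Let lag_cvg : lag k @[k --> \oo] --> limn V.
Proof.
have [cV P0 _] := V_cvg.
have -> : lag = (fun k => V k + delta / alpha * P k.+1
    - alpha * L ^+ 2 / (2 * delta) * P k).
  by apply/funext => k; rewrite /V; ring.
rewrite -[X in _ --> X]addr0 -[X in _ --> _ + X]subr0.
rewrite -[X in _ --> _ + (X - _)](mulr0 (delta / alpha)).
rewrite -[X in _ --> _ + (_ - X)](mulr0 (alpha * L ^+ 2 / (2 * delta))) addrA.
apply: cvgB; last by apply: cvgM => //; exact: cvg_cst.
apply: cvgD => //; apply: cvgM; first exact: cvg_cst.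
by rewrite (cvg_shiftS P).
Qed.

Let C := cluster ((fun k => (x k, y k)) @ \oo).

Let cluster_limits a b : C (a, b) -> exists phi : nat -> nat,
  [/\ forall j, (j <= phi j)%N, x (phi j).+1 @[j --> \oo] --> a,
      y (phi j).+1 @[j --> \oo] --> b & xi (phi j) @[j --> \oo] --> A a].
Proof.
move=> /cluster_subseq[phi [phi_ge xa yb]]; exists phi; split => //.
have phi1_ge j : (j <= (phi j).+1)%N by rewrite leqW.
apply: linear_cvg; rewrite -[a]addr0; apply: cvgD.
  (* [xi] involves x one index past the selected one, and that increment tends to 0. *)
  rewrite [X in X @ _](_ : _ = (fun j => x (phi j).+1 + p (phi j).+1)).
    by rewrite -[a]addr0; apply: cvgD => //; exact: cvg_subseq p_cvg0.
  by apply/funext => j; rewrite /p addrC subrK.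
rewrite -(scaler0 _ alpha); apply: cvgZ; first exact: cvg_cst.
exact: cvg_subseq d_cvg0.
Qed.

(** For fixed u, <y,u> - h(u) <= g(y) <= G(z) - <xi, z - y> along the subsequence. Both ends
    converge; taking the supremum over u afterwards yields the subgradient inequality, and a [z] in
    the domain makes g(b) finite. *)
Let cluster_subdiff a b : C (a, b) -> subdiff g b (A a).
Proof.
move=> /cluster_limits[phi [_ _ yb xiA]].
have gb z : g z \is a fin_num -> (g b <= (G z - '[A a, z - b])%:E)%E.
  move=> gz; apply/(fenchel_conj_leP h_gtNy) => u hu.
  have cvgl : '[y (phi j).+1, u] - fine (h u)
      @[j --> \oo] --> '[b, u] - fine (h u).
    by apply: cvgB; [apply: cvg_dotv => //; exact: cvg_cst|exact: cvg_cst].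
  have cvgr : G z - '[xi (phi j), z - y (phi j).+1] @[j --> \oo] -->
      G z - '[A a, z - b].
    apply: cvgB; first exact: cvg_cst.
    by apply: cvg_dotv => //; apply: cvgB => //; exact: cvg_cst.
  apply: (ler_cvg_to cvgl cvgr); apply: nearW => j.
  have : (g (y (phi j).+1) <= (G (y (phi j).+1))%:E)%E by rewrite /G fineK.
  move=> /(fenchel_conj_leP h_gtNy)/(_ u hu).
  have := xi_ineq (phi j) gz; lra.
have gb_fin : g b \is a fin_num.
  have [z gz] := fenchel_conj_proper h_gtNy hull_proper.
  apply: (fenchel_conj_fin_num h_gtNy hull_proper).
  exact: le_lt_trans (gb z gz) (ltry _).
apply/(subdiff_fenchel_conjP h_gtNy hull_proper); split => // z gz.
by have := gb z gz; rewrite -(fineK gb_fin) lee_fin /G; lra.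
Qed.

Lemma ppdg_cluster_crit : C `<=` crit_lagr gradf A At h.
Proof.
move=> [a b] Cab; split => /=; last first.
  by exists (A a); [exact: cluster_subdiff|rewrite subrr].
have [phi [phi_ge xa yb _]] := cluster_limits Cab.
have [_ _ gradf_cont] := f_C1.
have cvgl : gradf (x (phi j).+1) + At (y (phi j).+1) @[j --> \oo] -->
    gradf a + At b.
  apply: cvgD; last exact: linear_cvg.
  by apply: (continuous_cvg _ _ xa); exact: gradf_cont.
suff cvg0 : gradf (x (phi j).+1) + At (y (phi j).+1) @[j --> \oo] --> (0 : X).
  exact: (cvg_unique _ cvg0 cvgl).
(* By the primal step the x-residual is a multiple of an increment, which tends to 0. *)
rewrite (_ : (fun j => _) = (fun j => - alpha^-1 *: p (phi j).+1)).
  rewrite -(scaler0 _ (- alpha^-1)); apply: cvgZ; first exact: cvg_cst.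
  by apply: cvg_subseq p_cvg0 => j; rewrite leqW.
apply/funext => j; apply: (scalerI (lt0r_neq0 alpha_gt0)).
by rewrite scalerDr stepE scalerA mulrN divff ?gt_eqF// scaleN1r addrC subrK.
Qed.

(** Continuity of g at b is replaced by two subgradient inequalities: the one at y^(k+1) tested at
    b, and the one at b tested at y^(k+1), bound [lag] below and above by sequences with the same
    limit. *)
Lemma ppdg_lagr_cluster a b : C (a, b) -> lagr f A h a b = (limn V)%:E.
Proof.
move=> Cab; have := cluster_subdiff Cab.
move=> /(subdiff_fenchel_conjP h_gtNy hull_proper)[gb Ab].
have [phi [phi_ge xa yb xiA]] := cluster_limits Cab.
rewrite /lagr -(fineK gb) -EFinB -/(G b); congr (_%:E).
have lag_phi : lag (phi j) @[j --> \oo] --> limn V by exact: cvg_subseq lag_cvg.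
have smooth_cvg : f (x (phi j).+1) + '[y (phi j).+1, A (x (phi j).+1)]
    @[j --> \oo] --> f a + '[b, A a].
  apply: cvgD; first exact: (C1_cvg f_C1 _ xa).
  by apply: cvg_dotv => //; exact: linear_cvg.
apply/eqP; rewrite eq_le; apply/andP; split.
- have cvgl : f (x (phi j).+1) + '[y (phi j).+1, A (x (phi j).+1)]
      - (G b - '[xi (phi j), b - y (phi j).+1]) @[j --> \oo] -->
      f a + '[b, A a] - (G b - '[A a, b - b]).
    apply: cvgB => //; apply: cvgB; first exact: cvg_cst.
    by apply: cvg_dotv => //; apply: cvgB => //; exact: cvg_cst.
  move: cvgl; rewrite subrr dotv0 subr0 => cvgl.
  apply: (ler_cvg_to cvgl lag_phi); apply: nearW => j.
  by have := xi_ineq (phi j) gb; rewrite /lag; lra.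
- have cvgr : f (x (phi j).+1) + '[y (phi j).+1, A (x (phi j).+1)]
      - (G b + '[A a, y (phi j).+1 - b]) @[j --> \oo] -->
      f a + '[b, A a] - (G b + '[A a, b - b]).
    apply: cvgB => //; apply: cvgD; first exact: cvg_cst.
    by apply: cvg_dotv; [exact: cvg_cst|apply: cvgB => //; exact: cvg_cst].
  move: cvgr; rewrite subrr dotv0 addr0 => cvgr.
  apply: (ler_cvg_to lag_phi cvgr); apply: nearW => j.
  by have := Ab _ (y_dom (phi j)); rewrite /lag /G; lra.
Qed.

End Convergence.

Theorem theorem2p6 (R : realType) (X Y : euclideanType R)
  (f : X -> R) (gradf : X -> X) (h : Y -> \bar R)
  (A : 'Hom(X, Y)) (At : 'Hom(Y, X))
  (L alpha delta : R) (x : nat -> X) (y : nat -> Y)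
  (f_C1 : C1_with_gradient f gradf)
  (h_gtNy : forall u, (-oo < h u)%E)
  (A_adj : is_adjoint A At)
  (L_gt0 : 0 < L)
  (A1 : forall u v, `|gradf u - gradf v| <= L * `|u - v|)
  (A2 : forall v, (fenchel_conj h v < +oo)%E ->
     (-oo < ereal_inf (range (fun u => lagr f A h u v)))%E)
  (A3 : forall v, exists u, A u = v)
  (A4 : proper_efun (convex_hull_fun h))
  (alpha_gt0 : 0 < alpha) (delta_gt0 : 0 < delta)
  (a_gt0 : 0 < ppdg_a alpha delta)
  (b_gt0 : 0 < ppdg_b L alpha delta)
  (c_gt0 : 0 < ppdg_c L alpha delta)
  (xy_ppdg : ppdg_iteration gradf A At h alpha x y)
  (xy_bounded : bounded_set (range (fun k => (x k, y k)))) :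
  let C : set (X * Y) := cluster ((fun k => (x k, y k)) @ \oo) in
  [/\ (\sum_(1 <= k <oo) (`|x k.+1 - x k| ^+ 2)%:E < +oo)%E /\
      (\sum_(1 <= k <oo) (`|y k.+1 - y k| ^+ 2)%:E < +oo)%E,
      [/\ C !=set0, compact C &
          dist_to C (x k, y k) @[k --> \oo] --> 0%E],
      C `<=` crit_lagr gradf A At h &
      exists r : R, forall p, C p -> lagr f A h p.1 p.2 = r%:E].
Proof.
have [B [_ Bxy]] := xy_bounded.
(* Boundedness holds for every constant strictly above [B], hence for B + 1. *)
have xy_le k : `|(x k, y k)| <= B + 1 by apply: Bxy; [rewrite ltrDl|exists k].
have x_le k : `|x k| <= B + 1.
  by apply: le_trans (xy_le k); rewrite prod_normE le_max lexx.
have y_le k : `|y k| <= B + 1.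
  by apply: le_trans (xy_le k); rewrite prod_normE le_max lexx orbT.
have sum_x := ppdg_sum_x f_C1 h_gtNy A_adj L_gt0 A1 A3 A4 alpha_gt0 delta_gt0
  c_gt0 xy_ppdg x_le y_le.
have sum_y := ppdg_sum_y f_C1 h_gtNy A_adj L_gt0 A1 A3 A4 alpha_gt0 delta_gt0
  c_gt0 xy_ppdg x_le y_le.
have crit := ppdg_cluster_crit f_C1 h_gtNy A_adj L_gt0 A1 A3 A4 alpha_gt0
  delta_gt0 c_gt0 xy_ppdg x_le y_le.
have lagr_cst := ppdg_lagr_cluster f_C1 h_gtNy A_adj L_gt0 A1 A3 A4 alpha_gt0
  delta_gt0 c_gt0 xy_ppdg x_le y_le.
split=> //; first exact: dist_to_cluster_cvg x_le y_le.
(* The common value is the limit of [V], the same for every cluster point. *)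
by eexists => -[u v]; exact: lagr_cst.
Qed.
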